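(* Let $G$ be a commutative group and let $h\colon R\to S$ be a morphism of $G$-graded commutative rings. With $\sigma^h,\widetilde\rho^h,\gamma^h,\eta^h$ the natural morphisms defined in the context, the following statements are equivalent: (i) $h$ is an epimorphism in the category of $G$-graded (commutative) rings; (ii) $\sigma^h_S$ is an isomorphism; (iii) $\sigma^h$ is an isomorphism (i.e. $\sigma^h_N$ is an isomorphism for every $G$-graded $S$-module $N$); (iv) $\widetilde\rho^h$ is an isomorphism (i.e. $\widetilde\rho^h_N$ is an isomorphism for every $G$-graded $S$-module $N$); (v) $\gamma^h$ is an isomorphism (i.e. $\gamma^h_{M,N}$ is an isomorphism for all $G$-graded $S$-modules $M,N$); (vi) $\eta^h$ is an isomorphism (i.e. $\eta^h_{M,N}$ is an isomorphism for all $G$-graded $S$-modules $M,N$); (vii) $\eta^h_{S,\bullet}$ is an isomorphism (i.e. $\eta^h_{S,N}$ is an isomorphism for every $G$-graded $S$-module $N$).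
   Context: All groups and rings are commutative (rings unital). Morphisms of $G$-graded rings are degree-preserving ring homomorphisms. $\mathrm{Mod}^G(R)$ is the category of $G$-graded $R$-modules with degree-preserving $R$-linear maps; $M(g)$ is the shift, $M(g)_{g'}=M_{g+g'}$. The tensor product $M\otimes_RN$ is graded with $x\otimes y$ in degree $\deg x+\deg y$. $\mathrm{Hom}^G_R(M,N)=\bigoplus_{g\in G}\mathrm{Hom}_{\mathrm{Mod}^G(R)}(M,N(g))$, a $G$-graded $R$-module. Change of ring functors: $h_*\colon\mathrm{Mod}^G(S)\to\mathrm{Mod}^G(R)$ is restriction of scalars along $h$ (same grading, $rx=h(r)x$). $h^*\colon\mathrm{Mod}^G(R)\to\mathrm{Mod}^G(S)$, $h^*(M)=S\otimes_RM$ (the graded tensor product $h_*(S)\otimes_RM$ with $s(t\otimes x)=(st)\otimes x$). $\widetilde h\colon\mathrm{Mod}^G(R)\to\mathrm{Mod}^G(S)$, $\widetilde h(M)=\mathrm{Hom}^G_R(h_*(S),M)$ with $S$-action $(su)(t)=u(st)$. Natural morphisms, for $G$-graded $S$-modules $M,N$: - $\sigma^h_N\colon h^*(h_*(N))\to N$, $\sum_is_i\otimes x_i\mapsto\sum_is_ix_i$ in $\mathrm{Mod}^G(S)$; - $\widetilde\rho^h_N\colon N\to\widetilde h(h_*(N))$, $x\mapsto(s\mapsto sx)$ in $\mathrm{Mod}^G(S)$; - $\gamma^h_{M,N}\colon h_*(M)\otimes_Rh_*(N)\to h_*(M\otimes_SN)$, $x\otimes y\mapsto x\otimes y$ in $\mathrm{Mod}^G(R)$;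 - $\eta^h_{M,N}\colon h_*(\mathrm{Hom}^G_S(M,N))\to\mathrm{Hom}^G_R(h_*(M),h_*(N))$, $u\mapsto h_*(u)$ (regarding an $S$-linear map as $R$-linear) in $\mathrm{Mod}^G(R)$. *)

(* Defs.v *)
(* The classical axioms of [boolp] are used to form quotients and subtypes by
   undecidable predicates. *)
From HB Require Import structures.
From mathcomp Require Import all_boot ssralg ssrint generic_quotient ring_quotient.
From mathcomp Require Import boolp classical_sets functions.
From mathcomp.multinomials Require Import freeg.

Set Implicit Arguments.
Unset Strict Implicit.
Unset Printing Implicit Defensive.

Import GRing.Theory.
Local Open Scope ring_scope.

(* -------------------------------------------------------------------- *)
(* A grading is an internal direct sum decomposition: [homog g] is the
   subgroup of elements of degree g, the subgroups span M and their sum is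
   direct. *)
Record grading (G M : zmodType) := Grading {
  homog :> G -> set M;
  homog0 : forall g, homog g 0;
  homogB : forall g x y, homog g x -> homog g y -> homog g (x - y);
  homog_span : forall x, exists s : seq G, exists2 f : G -> M,
    uniq s /\ (forall g, homog g (f g)) & x = \sum_(g <- s) f g;
  homog_direct : forall (s : seq G) (f : G -> M),
    uniq s -> (forall g, homog g (f g)) -> \sum_(g <- s) f g = 0 ->
    forall g, g \in s -> f g = 0 }.

Section GradingTheory.
Variables (G M : zmodType) (A : grading G M).

Lemma homogN g x : A g x -> A g (- x).
Proof. by rewrite -sub0r; apply: homogB; apply: homog0. Qed.

Lemma homogD g x y : A g x -> A g y -> A g (x + y).
Proof. by move=> Ax /homogN Ay; rewrite -[y]opprK; apply: homogB. Qed.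

Lemma homog_sum g (I : eqType) (s : seq I) (f : I -> M) :
  (forall i, i \in s -> A g (f i)) -> A g (\sum_(i <- s) f i).
Proof.
by move=> h; rewrite big_seq; elim/big_ind: _; [apply: homog0|apply: homogD|].
Qed.

Lemma homog_ind (P : M -> Prop) :
  P 0 -> (forall x y, P x -> P y -> P (x + y)) ->
  (forall g x, A g x -> P x) -> forall x, P x.
Proof.
move=> P0 PD Ph x; have [s [f [_ hf] ->]] := homog_span A x.
by elim/big_ind: _ => // g _; apply: Ph (hf g).
Qed.

Lemma homog_exists_hcomp x : exists f : G -> M, (forall g, A g (f g)) /\
  exists2 s : seq G, uniq s & (forall g, g \notin s -> f g = 0) /\
    x = \sum_(g <- s) f g.
Proof.
have [s [f [us hf] ->]] := homog_span A x.
exists (fun g => if g \in s then f g else 0); split.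
  by move=> g; case: ifP => _; [apply: hf|apply: homog0].
exists s => //; split; first by move=> g /negbTE->.
by apply: eq_big_seq => g ->.
Qed.

Definition hcomp (x : M) : G -> M := projT1 (cid (homog_exists_hcomp x)).
Lemma hcomp_homog x g : A g (hcomp x g).
Proof. by have [] := projT2 (cid (homog_exists_hcomp x)). Qed.
Lemma hcomp_exists_hsupp x : exists s : seq G, [/\ uniq s,
  forall g, g \notin s -> hcomp x g = 0 & x = \sum_(g <- s) hcomp x g].
Proof.
by have [_ [s us [h e]]] := projT2 (cid (homog_exists_hcomp x)); exists s.
Qed.
Definition hsupp (x : M) : seq G := projT1 (cid (hcomp_exists_hsupp x)).
Lemma hsupp_uniq x : uniq (hsupp x).
Proof. by have [] := projT2 (cid (hcomp_exists_hsupp x)). Qed.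
Lemma hcomp_notin_hsupp x g : g \notin hsupp x -> hcomp x g = 0.
Proof. by have [_ h _] := projT2 (cid (hcomp_exists_hsupp x)); apply: h. Qed.
Lemma hcomp_sum x : x = \sum_(g <- hsupp x) hcomp x g.
Proof. by have [] := projT2 (cid (hcomp_exists_hsupp x)). Qed.

Lemma sum_hsupp (Z : zmodType) x (s : seq G) (F : G -> Z) : uniq s ->
  {subset hsupp x <= s} -> (forall g, hcomp x g = 0 -> F g = 0) ->
  \sum_(g <- hsupp x) F g = \sum_(g <- s) F g.
Proof.
move=> us sub F0; rewrite [RHS](bigID (mem (hsupp x))) /= [X in _ + X]big1.
  rewrite addr0 -[in RHS]big_filter; apply: perm_big.
  apply: uniq_perm (hsupp_uniq x) (filter_uniq _ us) _ => g.
  by rewrite mem_filter /=; case e: (g \in hsupp x) => //=; rewrite sub.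
by move=> g /hcomp_notin_hsupp /F0.
Qed.

Lemma hcomp_unique x (s : seq G) (f : G -> M) :
  uniq s -> (forall g, A g (f g)) -> (forall g, g \notin s -> f g = 0) ->
  x = \sum_(g <- s) f g -> hcomp x = f.
Proof.
move=> us hf f0 ex; apply/funext => g.
set t := undup (g :: s ++ hsupp x).
have ut : uniq t := undup_uniq _.
have gt : g \in t by rewrite mem_undup inE eqxx.
apply/eqP; rewrite -subr_eq0; apply/eqP.
apply: (@homog_direct _ _ A t (fun b => hcomp x b - f b)) => // [b|].
  exact: (homogB (hcomp_homog x b)).
rewrite sumrB -(@sum_hsupp _ x t) //; last first.
  by move=> a; rewrite mem_undup inE mem_cat => ->; rewrite !orbT.
rewrite -hcomp_sum {1}ex; apply/eqP; rewrite subr_eq0; apply/eqP.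
rewrite [RHS](bigID (mem s)) /= [X in _ + X]big1 ?addr0 // -[in RHS]big_filter.
apply: perm_big; apply: uniq_perm us (filter_uniq _ ut) _ => a.
by rewrite mem_filter /= mem_undup inE mem_cat; case: (a \in s); rewrite ?orbT.
Qed.

Lemma hcomp_homogE g x : A g x -> hcomp x = fun g' => if g' == g then x else 0.
Proof.
move=> hx; apply: (@hcomp_unique _ [:: g]) => //=.
- by move=> g'; case: eqP => [->|_] //; apply: homog0.
- by move=> g'; rewrite inE => /negbTE ->.
- by rewrite big_seq1 eqxx.
Qed.

Lemma hcompD x y : hcomp (x + y) = fun g => hcomp x g + hcomp y g.
Proof.
set s := undup (hsupp x ++ hsupp y).
have us : uniq s := undup_uniq _.
have sx : {subset hsupp x <= s} by move=> g; rewrite mem_undup mem_cat => ->.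
have sy : {subset hsupp y <= s}.
  by move=> g; rewrite mem_undup mem_cat => ->; rewrite orbT.
apply: (@hcomp_unique _ s) => //.
- by move=> g; apply: homogD; apply: hcomp_homog.
- by move=> g gs; rewrite !hcomp_notin_hsupp ?addr0 //;
    apply: contra gs; [apply: sy|apply: sx].
- by rewrite big_split /= -(@sum_hsupp _ x s) // -(@sum_hsupp _ y s) // -!hcomp_sum.
Qed.

End GradingTheory.

(* -------------------------------------------------------------------- *)
(* [comPzRingType] rather than [comNzRingType]: the zero ring is allowed. *)
Record gring (G : zmodType) := GRing {
  gring_sort :> comPzRingType;
  gring_deg : grading G gring_sort;
  gring_deg1 : gring_deg 0 1;
  gring_degM : forall g g' r r', gring_deg g r -> gring_deg g' r' ->
    gring_deg (g + g') (r * r') }.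

Record gring_hom (G : zmodType) (R S : gring G) := GRingHom {
  gring_fun :> {rmorphism R -> S};
  gring_fun_deg : forall g r, gring_deg R g r -> gring_deg S g (gring_fun r) }.

Definition gring_epi (G : zmodType) (R S : gring G) (h : gring_hom R S) :=
  forall (T : gring G) (f f' : gring_hom S T), f \o h =1 f' \o h -> f =1 f'.

(* -------------------------------------------------------------------- *)
Record gmod (G : zmodType) (R : gring G) := GMod {
  gmod_sort :> lmodType R;
  gmod_deg : grading G gmod_sort;
  gmod_degZ : forall g g' r x, gring_deg R g r -> gmod_deg g' x ->
    gmod_deg (g + g') (r *: x) }.

Record gmod_hom (G : zmodType) (R : gring G) (M N : gmod R) := GModHom {
  gmod_fun :> {linear M -> N};
  gmod_fun_deg : forall g x, gmod_deg M g x -> gmod_deg N g (gmod_fun x) }.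

Definition gmod_iso (G : zmodType) (R : gring G) (M N : gmod R)
    (f : gmod_hom M N) :=
  exists2 f' : gmod_hom N M, cancel f f' & cancel f' f.

Definition mk_gmod_hom (G : zmodType) (R : gring G) (M N : gmod R) (f : M -> N)
    (f_lin : linear f)
    (f_deg : forall g x, gmod_deg M g x -> gmod_deg N g (f x)) : gmod_hom M N :=
  @GModHom G R M N
    (HB.pack_for {linear M -> N} f (GRing.isLinear.Build R M N *:%R f f_lin))
    f_deg.

Section Regular.
Variables (G : zmodType) (S : gring G).

Definition greg_deg : grading G S^o :=
  @Grading G S^o (gring_deg S) (homog0 (gring_deg S)) (@homogB _ _ (gring_deg S))
    (@homog_span _ _ (gring_deg S)) (@homog_direct _ _ (gring_deg S)).

Definition greg : gmod S := @GMod G S S^o greg_deg (@gring_degM G S).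
End Regular.

(* M(g0), with M(g0)_g = M_(g0 + g) *)
Section Shift.
Variables (G : zmodType) (R : gring G) (M : gmod R) (g0 : G).

Lemma shift_span (x : M) : exists s : seq G, exists2 f : G -> M,
  uniq s /\ (forall g, gmod_deg M (g0 + g) (f g)) & x = \sum_(g <- s) f g.
Proof.
have [s [f [us hf] ->]] := homog_span (gmod_deg M) x.
exists [seq g - g0 | g <- s], (fun g => f (g0 + g)); first split => //.
  by rewrite map_inj_uniq //; apply: addIr.
by rewrite big_map; apply: eq_bigr => g _; rewrite addrC subrK.
Qed.

Lemma shift_direct (s : seq G) (f : G -> M) :
  uniq s -> (forall g, gmod_deg M (g0 + g) (f g)) -> \sum_(g <- s) f g = 0 ->
  forall g, g \in s -> f g = 0.
Proof.
move=> us hf e g gs.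
have := @homog_direct _ _ (gmod_deg M) [seq g0 + g | g <- s]
  (fun g => f (g - g0)).
move=> /(_ _ _ _ (g0 + g)); rewrite addrAC subrr add0r; apply.
- by rewrite map_inj_uniq //; apply: addrI.
- by move=> a; have := hf (a - g0); rewrite addrC subrK.
- by rewrite big_map -[RHS]e; apply: eq_bigr => a _; rewrite addrAC subrr add0r.
- by apply/mapP; exists g.
Qed.

Definition shift_deg : grading G M :=
  @Grading G M (fun g => gmod_deg M (g0 + g)) (fun g => homog0 _ _)
    (fun g => @homogB _ _ _ _) shift_span shift_direct.

Lemma shift_degZ g g' (r : R) (x : M) :
  gring_deg R g r -> shift_deg g' x -> shift_deg (g + g') (r *: x).
Proof. by move=> hr hx; rewrite /= addrCA; apply: gmod_degZ. Qed.

Definition gshift : gmod R := @GMod G R M shift_deg shift_degZ.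
End Shift.

(* -------------------------------------------------------------------- *)
(* Restriction of scalars h_* *)
Definition res_type (R S : pzRingType) (h : {rmorphism R -> S})
  (N : lmodType S) : Type := N.

Section ResType.
Variables (R S : pzRingType) (h : {rmorphism R -> S}) (N : lmodType S).
HB.instance Definition _ := GRing.Zmodule.on (res_type h N).

Definition res_scale (r : R) (x : res_type h N) : res_type h N :=
  h r *: (x : N).

Fact res_scaleA a b x : res_scale a (res_scale b x) = res_scale (a * b) x.
Proof. by rewrite /res_scale scalerA rmorphM. Qed.
Fact res_scale1 : left_id 1 res_scale.
Proof. by move=> x; rewrite /res_scale rmorph1 scale1r. Qed.
Fact res_scaleDr : right_distributive res_scale +%R.
Proof. by move=> a x y; rewrite /res_scale scalerDr. Qed.
Fact res_scaleDl x : {morph res_scale^~ x : a b / a + b}.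
Proof. by move=> a b; rewrite /res_scale rmorphD scalerDl. Qed.

HB.instance Definition _ := GRing.Zmodule_isLmodule.Build R (res_type h N)
  res_scaleA res_scale1 res_scaleDr res_scaleDl.
End ResType.

Section Res.
Variables (G : zmodType) (R S : gring G) (h : gring_hom R S) (N : gmod S).

Definition res_deg : grading G (res_type h N) :=
  @Grading G (res_type h N) (gmod_deg N) (homog0 (gmod_deg N))
    (@homogB _ _ (gmod_deg N)) (@homog_span _ _ (gmod_deg N))
    (@homog_direct _ _ (gmod_deg N)).

Lemma res_degZ g g' (r : R) (x : res_type h N) :
  gring_deg R g r -> res_deg g' x -> res_deg (g + g') (r *: x).
Proof. by move=> hr hx; apply: (@gmod_degZ G S N) => //; apply: gring_fun_deg. Qed.

Definition gres : gmod R := @GMod G R (res_type h N) res_deg res_degZ.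
End Res.

(* -------------------------------------------------------------------- *)
(* The tensor product of two modules over a commutative ring: the free
   abelian group on U * V modulo the usual relations. *)
Section Tensor.
Variables (R : comPzRingType) (U V : lmodType R).
Local Notation F := {freeg (U * V)%type / int}.
Local Notation gen x y := (<< (x, y) >> : F).

Inductive tensor_rel : F -> Prop :=
| tensor_rel0 : tensor_rel 0
| tensor_relB a b : tensor_rel a -> tensor_rel b -> tensor_rel (a - b)
| tensor_relDl x x' y : tensor_rel (gen (x + x') y - gen x y - gen x' y)
| tensor_relDr x y y' : tensor_rel (gen x (y + y') - gen x y - gen x y')
| tensor_relZ r x y : tensor_rel (gen (r *: x) y - gen x (r *: y)).

Definition tensor_null : {pred F} := fun a => `[< tensor_rel a >].

Fact tensor_null_zmod : zmod_closed tensor_null.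
Proof.
split; first exact/asboolP/tensor_rel0.
by move=> a b /asboolP ha /asboolP hb; apply/asboolP/tensor_relB.
Qed.
HB.instance Definition _ := GRing.isZmodClosed.Build F tensor_null
  tensor_null_zmod.

Definition tensor : Type := Quotient.quot tensor_null.
HB.instance Definition _ := GRing.Zmodule.on tensor.

Definition tensor_pi : F -> tensor := (\pi_(Quotient.quot tensor_null))%qT.

Definition tens (x : U) (y : V) : tensor := tensor_pi (gen x y).

Lemma tensor_eq (a b : F) : tensor_rel (a - b) -> tensor_pi a = tensor_pi b.
Proof.
by move=> h; apply/eqP; rewrite -Quotient.idealrBE; apply/asboolP.
Qed.

Lemma tensor_rel_of (a b : F) : tensor_pi a = tensor_pi b -> tensor_rel (a - b).
Proof. by move=> /eqP; rewrite -Quotient.idealrBE => /asboolP. Qed.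

Lemma tensor_piP (t : tensor) : exists a, t = tensor_pi a.
Proof. by exists (repr (t : Quotient.quot tensor_null)); rewrite /tensor_pi reprK. Qed.

HB.instance Definition _ := GRing.isZmodMorphism.Build F tensor tensor_pi
  (@raddfB _ _ (\pi_(Quotient.quot tensor_null))%qT).

Lemma tensDl x x' y : tens (x + x') y = tens x y + tens x' y.
Proof.
by rewrite /tens -raddfD; apply: tensor_eq; rewrite opprD addrA;
  apply: tensor_relDl.
Qed.
Lemma tensDr x y y' : tens x (y + y') = tens x y + tens x y'.
Proof.
by rewrite /tens -raddfD; apply: tensor_eq; rewrite opprD addrA;
  apply: tensor_relDr.
Qed.
Lemma tensZ r x y : tens (r *: x) y = tens x (r *: y).
Proof. exact/tensor_eq/tensor_relZ. Qed.

Lemma tens0l y : tens 0 y = 0.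
Proof. by apply: (addrI (tens 0 y)); rewrite -tensDl !addr0. Qed.
Lemma tens0r x : tens x 0 = 0.
Proof. by apply: (addrI (tens x 0)); rewrite -tensDr !addr0. Qed.
Lemma tensNl x y : tens (- x) y = - tens x y.
Proof.
by apply: (addrI (tens x y)); rewrite -tensDl !subrr tens0l.
Qed.

Lemma tensor_sum (t : tensor) :
  exists s : seq (U * V), t = \sum_(p <- s) tens p.1 p.2.
Proof.
have [a ->] := tensor_piP t; rewrite -[a]freeg_sumE.
rewrite raddf_sum; elim: (dom a) => [|[x y] s [s' IH]].
  by exists [::]; rewrite !big_nil.
suff [s1 e1] : exists s1 : seq (U * V),
    tensor_pi << coeff (x, y) a *g (x, y) >>
    = \sum_(p <- s1) tens p.1 p.2.
  by exists (s1 ++ s'); rewrite big_cons big_cat /= e1 -IH.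
have e : << coeff (x, y) a *g (x, y) >> = gen x y *~ coeff (x, y) a.
  by rewrite freegU_mulz intz.
rewrite e raddfMz.
case: (coeff _ a) => n.
  by exists (nseq n (x, y)); rewrite -pmulrn big_nseq iter_addr_0.
exists (nseq n.+1 (- x, y)).
by rewrite NegzE -nmulrn big_nseq iter_addr_0 /= tensNl mulNrn.
Qed.

Lemma tensor_ind (P : tensor -> Prop) :
  P 0 -> (forall x y, P (tens x y)) -> (forall t u, P t -> P u -> P (t + u)) ->
  forall t, P t.
Proof.
by move=> P0 Pt PD t; have [s ->] := tensor_sum t; elim/big_ind: _.
Qed.

Section Lift.
Variables (Z : zmodType) (f : U -> V -> Z).

Definition tensor_lift (t : tensor) : Z :=
  fglift (fun p : U * V => f p.1 p.2 : zmodule Z) (repr (t : Quotient.quot tensor_null)).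

(* R-balanced biadditive maps *)
Definition balanced := [/\ forall x x' y, f (x + x') y = f x y + f x' y,
  forall x y y', f x (y + y') = f x y + f x y' &
  forall r x y, f (r *: x) y = f x (r *: y)].

Hypothesis fB : balanced.
Local Notation fl := (fglift (fun p : U * V => f p.1 p.2 : zmodule Z)).

Let flB a b : fl (a - b) = fl a - fl b.
Proof. exact: (lift_is_additive (fun p : U * V => f p.1 p.2 : zmodule Z)). Qed.

Let fl1 x y : fl (gen x y) = f x y.
Proof. by rewrite liftU scale1r. Qed.

Let fl_rel a : tensor_rel a -> fl a = 0.
Proof.
case: fB => fDl fDr fZ; elim=> {a}.
- by rewrite -(subrr 0) flB subrr.
- by move=> a b _ ea _ eb; rewrite flB ea eb subrr.
- by move=> x x' y; rewrite !flB !fl1 fDl addrAC addrK subrr.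
- by move=> x y y'; rewrite !flB !fl1 fDr addrAC addrK subrr.
- by move=> r x y; rewrite flB !fl1 fZ subrr.
Qed.

Let fl_pi (a : F) : tensor_lift (tensor_pi a) = fl a.
Proof.
apply/eqP; rewrite -subr_eq0 /tensor_lift -flB; apply/eqP/fl_rel.
by apply: tensor_rel_of; rewrite /tensor_pi reprK.
Qed.

Lemma tensor_lift_tens x y : tensor_lift (tens x y) = f x y.
Proof. by rewrite fl_pi fl1. Qed.

Lemma tensor_liftB t u : tensor_lift (t - u) = tensor_lift t - tensor_lift u.
Proof.
have [a ->] := tensor_piP t; have [b ->] := tensor_piP u.
by rewrite -raddfB !fl_pi flB.
Qed.

Lemma tensor_lift0 : tensor_lift 0 = 0.
Proof. by have := tensor_liftB 0 0; rewrite !subrr. Qed.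
Lemma tensor_liftD t u : tensor_lift (t + u) = tensor_lift t + tensor_lift u.
Proof.
have := tensor_liftB t (0 - u); rewrite (tensor_liftB 0 u) tensor_lift0.
by rewrite !sub0r !opprK.
Qed.
Lemma tensor_lift_sum (I : Type) (s : seq I) (F : I -> tensor) :
  tensor_lift (\sum_(i <- s) F i) = \sum_(i <- s) tensor_lift (F i).
Proof. exact: (big_morph _ tensor_liftD tensor_lift0). Qed.
End Lift.

(* The action of an R-linear endomorphism of the left factor. *)
Section MapL.
Variables (phi : U -> U) (phi_lin : linear phi).

Definition tensor_mapl : tensor -> tensor :=
  tensor_lift (fun x y => tens (phi x) y).

Let phiD x y : phi (x + y) = phi x + phi y.
Proof. by have := phi_lin 1 x y; rewrite !scale1r. Qed.
Let phi0 : phi 0 = 0.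
Proof. by apply: (addrI (phi 0)); rewrite -phiD !addr0. Qed.
Let phiZ r x : phi (r *: x) = r *: phi x.
Proof. by have := phi_lin r x 0; rewrite phi0 !addr0. Qed.

Lemma mapl_balanced : balanced (fun x y => tens (phi x) y).
Proof.
by split=> *; rewrite ?phiD ?tensDl ?tensDr ?phiZ ?tensZ.
Qed.
Lemma tensor_mapl_tens x y : tensor_mapl (tens x y) = tens (phi x) y.
Proof. by rewrite /tensor_mapl tensor_lift_tens //; apply: mapl_balanced. Qed.
Lemma tensor_maplD t u : tensor_mapl (t + u) = tensor_mapl t + tensor_mapl u.
Proof. exact/tensor_liftD/mapl_balanced. Qed.
Lemma tensor_mapl0 : tensor_mapl 0 = 0.
Proof. exact/tensor_lift0/mapl_balanced. Qed.
End MapL.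

Definition tensor_scale (r : R) : tensor -> tensor :=
  tensor_mapl (fun x => r *: x).

Let scale_lin (r : R) : linear (fun x : U => r *: x).
Proof. by move=> a x y; rewrite scalerDr !scalerA mulrC. Qed.

Fact tensor_scaleA a b t :
  tensor_scale a (tensor_scale b t) = tensor_scale (a * b) t.
Proof.
elim/tensor_ind: t => [|x y|t u et eu].
- by rewrite /tensor_scale !tensor_mapl0.
- by rewrite /tensor_scale !tensor_mapl_tens // scalerA.
- by move: et eu; rewrite /tensor_scale !tensor_maplD // => -> ->.
Qed.
Fact tensor_scale1 : left_id 1 tensor_scale.
Proof.
move=> t; elim/tensor_ind: t => [|x y|t u et eu].
- by rewrite /tensor_scale !tensor_mapl0.
- by rewrite /tensor_scale !tensor_mapl_tens // scale1r.
- by move: et eu; rewrite /tensor_scale !tensor_maplD // => -> ->.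
Qed.
Fact tensor_scaleDr : right_distributive tensor_scale +%R.
Proof. by move=> a t u; rewrite /tensor_scale tensor_maplD. Qed.
Fact tensor_scaleDl t : {morph tensor_scale^~ t : a b / a + b}.
Proof.
move=> a b; elim/tensor_ind: t => [|x y|t u et eu].
- by rewrite /tensor_scale !tensor_mapl0 // addr0.
- by rewrite /tensor_scale !tensor_mapl_tens // scalerDl tensDl.
- by move: et eu; rewrite /tensor_scale !tensor_maplD // => -> ->; rewrite addrACA.
Qed.

HB.instance Definition _ := GRing.Zmodule_isLmodule.Build R tensor
  tensor_scaleA tensor_scale1 tensor_scaleDr tensor_scaleDl.

Lemma tensor_scale_tens r x y : r *: tens x y = tens (r *: x) y.
Proof. exact: tensor_mapl_tens. Qed.
End Tensor.

Section GTensor.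
Variables (G : zmodType) (R : gring G) (M N : gmod R).
Local Notation T := (tensor M N).
Implicit Types (t u : T).

Definition tensor_homog (g : G) : set T := fun t =>
  exists2 s : seq (M * N), t = \sum_(p <- s) tens p.1 p.2 &
  forall p, p \in s -> exists a b,
    [/\ gmod_deg M a p.1, gmod_deg N b p.2 & a + b = g].

Lemma tensor_homog_tens a b x y : gmod_deg M a x -> gmod_deg N b y ->
  tensor_homog (a + b) (tens x y).
Proof.
move=> hx hy; exists [:: (x, y)]; first by rewrite big_seq1.
by move=> p; rewrite inE => /eqP ->; exists a, b.
Qed.

Lemma tensor_homog0 g : tensor_homog g 0.
Proof. by exists [::]; rewrite ?big_nil. Qed.

Lemma tensor_homogD g t u :
  tensor_homog g t -> tensor_homog g u -> tensor_homog g (t + u).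
Proof.
move=> [s -> hs] [s' -> hs']; exists (s ++ s'); first by rewrite big_cat.
by move=> p; rewrite mem_cat => /orP[/hs|/hs'].
Qed.

Lemma tensor_homogN g t : tensor_homog g t -> tensor_homog g (- t).
Proof.
move=> [s -> hs]; exists [seq (- p.1, p.2) | p <- s].
  by rewrite big_map -sumrN; apply: eq_bigr => p _; rewrite tensNl.
move=> _ /mapP[p /hs [a [b [ha hb e]]] ->]; exists a, b; split=> //.
exact: homogN.
Qed.

Lemma tensor_homogB g t u :
  tensor_homog g t -> tensor_homog g u -> tensor_homog g (t - u).
Proof. by move=> ht /tensor_homogN; apply: tensor_homogD. Qed.

Lemma sum_spanning (Z : zmodType) (D : G -> set Z) (D0 : forall g, D g 0)
    (DD : forall g x y, D g x -> D g y -> D g (x + y))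
    (I : Type) (s : seq I) (F : I -> Z) : (forall i, exists g, D g (F i)) ->
  exists s' : seq G, exists2 f : G -> Z,
    uniq s' /\ (forall g, D g (f g)) & \sum_(i <- s) F i = \sum_(g <- s') f g.
Proof.
move=> hF; elim: s => [|i s [s' [f [us hf] e]]].
  by exists [::], (fun=> 0); rewrite ?big_nil.
have [g hg] := hF i.
pose f' a := if a == g then F i + (if g \in s' then f g else 0) else f a.
exists (if g \in s' then s' else g :: s'), f'.
  split; first by case: ifP => //= ->.
  move=> a; rewrite /f'; case: eqP => [->|//].
  by apply: DD => //; case: ifP.
rewrite big_cons e /f'; case: ifP => gs.
  rewrite !(bigD1_seq g gs us) /= eqxx addrA; congr (_ + _).
  by apply: eq_bigr => a /negbTE ->.
rewrite big_cons eqxx addr0; congr (_ + _).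
apply: eq_big_seq => a ha; case: eqP => // ea.
by rewrite -ea ha in gs.
Qed.

Lemma tensor_homog_span t : exists s : seq G, exists2 f : G -> T,
  uniq s /\ (forall g, tensor_homog g (f g)) & t = \sum_(g <- s) f g.
Proof.
have [s ->] := tensor_sum t.
have [s' ->] : exists s' : seq ((M * N) * (G * G)),
    \sum_(p <- s) tens p.1 p.2 =
    \sum_(q <- s') tens (hcomp (gmod_deg M) q.1.1 q.2.1)
                        (hcomp (gmod_deg N) q.1.2 q.2.2).
  elim: s => [|[x y] s [s' e]]; first by exists [::]; rewrite !big_nil.
  exists ([seq ((x, y), (a, b)) | a <- hsupp (gmod_deg M) x,
                                  b <- hsupp (gmod_deg N) y] ++ s').
  rewrite big_cons big_cat -e /=; congr (_ + _).
  rewrite big_allpairs_dep /=.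
  rewrite {1}(hcomp_sum (gmod_deg M) x).
  rewrite (big_morph (fun x' => tens x' y) (id1 := 0) (op1 := +%R)) //;
    [|by move=> *; rewrite tensDl|exact: tens0l].
  apply: eq_bigr => a _.
  rewrite {1}(hcomp_sum (gmod_deg N) y).
  rewrite (big_morph (tens _) (id1 := 0) (op1 := +%R)) //;
    [by move=> *; rewrite tensDr|exact: tens0r].
apply: sum_spanning => [|g *|q]; first exact: tensor_homog0.
  exact: tensor_homogD.
exists (q.2.1 + q.2.2); apply: tensor_homog_tens; exact: hcomp_homog.
Qed.

(* The projection onto the component of degree g, used to see that the sum
   of the components is direct. *)
Let proj2 g (x : M) (y : N) : T :=
  \sum_(a <- hsupp (gmod_deg M) x)
    tens (hcomp (gmod_deg M) x a) (hcomp (gmod_deg N) y (g - a)).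

Let proj2_homog g a b x y : gmod_deg M a x -> gmod_deg N b y ->
  proj2 g x y = if a + b == g then tens x y else 0.
Proof.
move=> hx hy; rewrite /proj2.
rewrite (@sum_hsupp _ _ _ _ _ (undup (a :: hsupp (gmod_deg M) x)))
  ?undup_uniq //; first last.
- by move=> c ->; rewrite tens0l.
- by move=> c hc; rewrite mem_undup inE hc orbT.
rewrite (bigD1_seq a) ?undup_uniq ?mem_undup ?inE ?eqxx //= big1 ?addr0.
  rewrite (hcomp_homogE hx) (hcomp_homogE hy) eqxx.
  have -> : (g - a == b) = (a + b == g) by rewrite subr_eq eq_sym addrC.
  by case: ifP => // _; rewrite tens0r.
by move=> c /negbTE nc; rewrite (hcomp_homogE hx) nc tens0l.
Qed.

Let proj2_balanced g : balanced (proj2 g).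
Proof.
have Dl x x' y : proj2 g (x + x') y = proj2 g x y + proj2 g x' y.
  set s := undup (hsupp (gmod_deg M) x ++ hsupp (gmod_deg M) x' ++
                  hsupp (gmod_deg M) (x + x')).
  rewrite /proj2 !(@sum_hsupp _ _ _ _ _ s) ?undup_uniq //;
    try by move=> c ->; rewrite tens0l.
  - rewrite -big_split /=; apply: eq_bigr => a _.
    by rewrite hcompD tensDl.
  - by move=> c hc; rewrite mem_undup !mem_cat hc ?orbT.
  - by move=> c hc; rewrite mem_undup !mem_cat hc ?orbT.
  - by move=> c hc; rewrite mem_undup !mem_cat hc ?orbT.
have Dr x y y' : proj2 g x (y + y') = proj2 g x y + proj2 g x y'.
  by rewrite /proj2 -big_split /=; apply: eq_bigr => a _; rewrite hcompD tensDr.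
have r0 x : proj2 g x 0 = 0.
  by apply: (addrI (proj2 g x 0)); rewrite -Dr !addr0.
have l0 y : proj2 g 0 y = 0.
  by apply: (addrI (proj2 g 0 y)); rewrite -Dl !addr0.
split=> // r x y.
elim/(homog_ind (A := gring_deg R)): r => [|r r' e e'|k r hr].
- by rewrite !scale0r r0 l0.
- by rewrite !scalerDl Dl Dr e e'.
elim/(homog_ind (A := gmod_deg M)): x => [|x x' e e'|a x hx].
- by rewrite scaler0 !l0.
- by rewrite scalerDr !Dl e e'.
elim/(homog_ind (A := gmod_deg N)): y => [|y y' e e'|b y hy].
- by rewrite scaler0 !r0.
- by rewrite scalerDr !Dr e e'.
rewrite (proj2_homog _ (gmod_degZ hr hx) hy).
by rewrite (proj2_homog _ hx (gmod_degZ hr hy)) tensZ -addrA (addrCA a).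
Qed.

Let proj g : T -> T := tensor_lift (proj2 g).

Let projE g g' t : tensor_homog g' t -> proj g t = if g' == g then t else 0.
Proof.
move=> [s -> hs]; rewrite /proj tensor_lift_sum //.
have [e|ne] := eqVneq g' g; [apply: eq_big_seq|rewrite big_seq big1 //];
  move=> p /hs [a [b [ha hb e']]];
  rewrite tensor_lift_tens // (proj2_homog _ ha hb) e'.
  by rewrite e eqxx.
by rewrite (negbTE ne).
Qed.

Lemma tensor_homog_direct (s : seq G) (f : G -> T) :
  uniq s -> (forall g, tensor_homog g (f g)) -> \sum_(g <- s) f g = 0 ->
  forall g, g \in s -> f g = 0.
Proof.
move=> us hf e g gs; have := congr1 (proj g) e.
rewrite /proj tensor_lift0 // tensor_lift_sum // (bigD1_seq g) //= -!/(proj _).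
rewrite (projE _ (hf g)) eqxx big1 ?addr0 // => a na.
by rewrite -/(proj g _) (projE _ (hf a)) (negbTE na).
Qed.

Definition tensor_deg : grading G T :=
  Grading tensor_homog0 tensor_homogB tensor_homog_span tensor_homog_direct.

Lemma tensor_degZ g g' (r : R) t :
  gring_deg R g r -> tensor_deg g' t -> tensor_deg (g + g') (r *: t).
Proof.
move=> hr [s -> hs]; rewrite scaler_sumr; apply: homog_sum => p /hs.
move=> [a [b [ha hb <-]]]; rewrite tensor_scale_tens addrA.
by apply: tensor_homog_tens => //; apply: gmod_degZ.
Qed.

Definition gtensor : gmod R := @GMod G R T tensor_deg tensor_degZ.
End GTensor.

(* -------------------------------------------------------------------- *)
(* Extension of scalars h^*(M): the underlying graded R-module is the tensor
   product of h_*(S) and M, and s acts by t (x) x |-> (s t) (x) x *)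
Definition ext_type (R S : comPzRingType) (h : {rmorphism R -> S})
  (M : lmodType R) : Type := tensor (res_type h S^o) M.

Section ExtType.
Variables (R S : comPzRingType) (h : {rmorphism R -> S}) (M : lmodType R).
Local Notation hS := (res_type h S^o).
HB.instance Definition _ := GRing.Zmodule.on (ext_type h M).

Definition ext_scale (s : S) : ext_type h M -> ext_type h M :=
  tensor_mapl (fun t : hS => s * (t : S)).

Let mul_lin (s : S) : linear (fun t : hS => s * (t : S) : hS).
Proof.
have key (b x y : S) : s * (b * x + y) = b * (s * x) + s * y.
  by rewrite mulrDr mulrCA.
move=> a x y; exact: key.
Qed.

Lemma ext_scale_tens s t x : ext_scale s (tens (t : hS) x) = tens (s * t : hS) x.
Proof. exact: (tensor_mapl_tens (@mul_lin s)). Qed.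
Let ext_scale0 s : ext_scale s 0 = 0.
Proof. exact: (tensor_mapl0 _ (@mul_lin s)). Qed.
Let ext_scaleD s t u : ext_scale s (t + u) = ext_scale s t + ext_scale s u.
Proof. exact: (tensor_maplD (@mul_lin s)). Qed.

Fact ext_scaleA a b t : ext_scale a (ext_scale b t) = ext_scale (a * b) t.
Proof.
elim/tensor_ind: t => [|x y|t u et eu].
- by rewrite !ext_scale0.
- by rewrite !ext_scale_tens mulrA.
- by rewrite !ext_scaleD et eu.
Qed.
Fact ext_scale1 : left_id 1 ext_scale.
Proof.
move=> t; elim/tensor_ind: t => [|x y|t u et eu].
- by rewrite !ext_scale0.
- by rewrite !ext_scale_tens mul1r.
- by rewrite !ext_scaleD et eu.
Qed.
Fact ext_scaleDr : right_distributive ext_scale +%R.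
Proof. exact: ext_scaleD. Qed.
Fact ext_scaleDl t : {morph ext_scale^~ t : a b / a + b}.
Proof.
move=> a b; elim/tensor_ind: t => [|x y|t u et eu].
- by rewrite !ext_scale0 addr0.
- by rewrite !ext_scale_tens mulrDl tensDl.
- by rewrite !ext_scaleD et eu addrACA.
Qed.

HB.instance Definition _ := GRing.Zmodule_isLmodule.Build S (ext_type h M)
  ext_scaleA ext_scale1 ext_scaleDr ext_scaleDl.
End ExtType.

Section Ext.
Variables (G : zmodType) (R S : gring G) (h : gring_hom R S) (M : gmod R).

(* same grading as [gtensor (gres h (greg S)) M] *)
Definition ext_deg : grading G (ext_type h M) :=
  let A := tensor_deg (gres h (greg S)) M in
  @Grading G (ext_type h M) A (homog0 A) (@homogB _ _ A)
    (@homog_span _ _ A) (@homog_direct _ _ A).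

Lemma ext_degZ g g' (s : S) (t : ext_type h M) :
  gring_deg S g s -> ext_deg g' t -> ext_deg (g + g') (s *: t).
Proof.
move=> hs [l -> hl]; rewrite scaler_sumr; apply: homog_sum => p /hl.
move=> [a [b [ha hb <-]]]; rewrite [_ *: _]ext_scale_tens addrA.
apply: (@tensor_homog_tens _ _ (gres h (greg S)) M) => //.
exact: gring_degM.
Qed.

Definition gext : gmod S := @GMod G S (ext_type h M) ext_deg ext_degZ.
End Ext.

(* -------------------------------------------------------------------- *)
(* The graded Hom module: the direct sum over g of the groups
   Hom_{Mod^G(R)}(M, N(g)), realized inside the module of maps M -> N (a finite
   family (u_g) is identified with the map sum_g u_g; that the sum is direct is
   proved in [ghom_direct]). *)
Section GHom.
Variables (G : zmodType) (R : gring G) (M N : gmod R).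

Definition hom_shift (g : G) : set (M -> N) :=
  fun u => exists v : gmod_hom M (gshift N g), u = v.

Definition is_ghom (u : M -> N) : Prop :=
  exists s : seq G, exists2 f : G -> M -> N,
    uniq s /\ (forall g, hom_shift g (f g)) & u = \sum_(g <- s) f g.

Lemma hom_shiftP g (u : M -> N) : linear u ->
  (forall a x, gmod_deg M a x -> gmod_deg N (g + a) (u x)) -> hom_shift g u.
Proof. by move=> u_lin u_deg; exists (@mk_gmod_hom G R M (gshift N g) u u_lin u_deg). Qed.

Lemma hom_shift_linear g (u : M -> N) : hom_shift g u -> linear u.
Proof. by move=> [v ->] a x y; rewrite linearP. Qed.

Lemma hom_shift_deg g (u : M -> N) a x :
  hom_shift g u -> gmod_deg M a x -> gmod_deg N (g + a) (u x).
Proof. by move=> [v ->] hx; apply: (gmod_fun_deg v hx). Qed.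

Lemma hom_shift0 g : hom_shift g 0.
Proof.
apply: hom_shiftP => [a x y|a x _]; last exact: homog0.
by rewrite /= scaler0 addr0.
Qed.
Lemma hom_shiftD g u v : hom_shift g u -> hom_shift g v -> hom_shift g (u + v).
Proof.
move=> hu hv; apply: hom_shiftP => [a x y|a x hx].
  have -> z : (u + v) z = u z + v z by [].
  by rewrite (hom_shift_linear hu) (hom_shift_linear hv) scalerDr addrACA.
by apply: homogD; apply: hom_shift_deg.
Qed.
Lemma hom_shiftN g u : hom_shift g u -> hom_shift g (- u).
Proof.
move=> hu; apply: hom_shiftP => [a x y|a x hx].
  have -> z : (- u) z = - u z by [].
  by rewrite (hom_shift_linear hu) opprD scalerN.
by apply: homogN; apply: hom_shift_deg.
Qed.
Lemma hom_shiftZ g g' (r : R) u :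
  gring_deg R g r -> hom_shift g' u -> hom_shift (g + g') (r *: u).
Proof.
move=> hr hu; apply: hom_shiftP => [a x y|a x hx].
  have -> z : (r *: u) z = r *: u z by [].
  by rewrite (hom_shift_linear hu) scalerDr !scalerA mulrC.
by rewrite -addrA; apply: gmod_degZ => //; apply: hom_shift_deg.
Qed.

Lemma is_ghom0 : is_ghom 0.
Proof.
by exists [::], (fun=> 0); rewrite ?big_nil; split => // g; apply: hom_shift0.
Qed.
Lemma is_ghom_shift g u : hom_shift g u -> is_ghom u.
Proof.
move=> hu; exists [:: g], (fun a => if a == g then u else 0).
  by split=> // a; case: eqP => [->|_] //; apply: hom_shift0.
by rewrite big_seq1 eqxx.
Qed.
Lemma is_ghom_sum (I : Type) (s : seq I) (f : I -> M -> N) :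
  (forall i, exists g, hom_shift g (f i)) -> is_ghom (\sum_(i <- s) f i).
Proof.
move=> hf; apply: (sum_spanning (D := hom_shift)) hf; first exact: hom_shift0.
by move=> *; apply: hom_shiftD.
Qed.
Lemma is_ghomD u v : is_ghom u -> is_ghom v -> is_ghom (u + v).
Proof.
move=> [s [f [_ hf] ->]] [s' [f' [_ hf'] ->]].
pose F (i : G + G) := match i with inl g => f g | inr g => f' g end.
have -> : \sum_(g <- s) f g + \sum_(g <- s') f' g =
    \sum_(i <- map inl s ++ map inr s') F i by rewrite big_cat !big_map.
by apply: is_ghom_sum => -[] g; exists g.
Qed.
Lemma is_ghomN u : is_ghom u -> is_ghom (- u).
Proof.
move=> [s [f [_ hf] ->]]; rewrite -sumrN; apply: is_ghom_sum => g.
by exists g; apply: hom_shiftN.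
Qed.
Lemma is_ghomZ r u : is_ghom u -> is_ghom (r *: u).
Proof.
elim/(homog_ind (A := gring_deg R)): r u => [u _|r r' h h' u hu|g r hr u].
- by rewrite scale0r; apply: is_ghom0.
- by rewrite scalerDl; apply: is_ghomD; [apply: h|apply: h'].
- move=> [s [f [_ hf] ->]]; rewrite scaler_sumr; apply: is_ghom_sum => a.
  by exists (g + a); apply: hom_shiftZ.
Qed.

Lemma is_ghom_linear u : is_ghom u -> linear u.
Proof.
move=> [s [f [_ hf] ->]] a x y; rewrite fct_sumE scaler_sumr -big_split /=.
by apply: eq_bigr => g _; rewrite (hom_shift_linear (hf g)).
Qed.

Lemma is_ghom_add u x y : is_ghom u -> u (x + y) = u x + u y.
Proof. by move=> /is_ghom_linear/(_ 1 x y); rewrite !scale1r. Qed.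

Definition ghom_pred : {pred (M -> N)} := fun u => `[< is_ghom u >].

Fact ghom_pred_closed : subsemimod_closed ghom_pred.
Proof.
split; first split.
- exact/asboolP/is_ghom0.
- by move=> u v /asboolP hu /asboolP hv; apply/asboolP/is_ghomD.
- by move=> r u /asboolP hu; apply/asboolP/is_ghomZ.
Qed.

Record ghom_type := GHom { ghom_fun :> M -> N; ghom_funP : ghom_fun \in ghom_pred }.

HB.instance Definition _ := [isSub for ghom_fun].
HB.instance Definition _ := [Choice of ghom_type by <:].
HB.instance Definition _ := GRing.SubChoice_isSubLmodule.Build R (M -> N)
  ghom_pred ghom_type ghom_pred_closed.

Definition ghom_of (u : M -> N) (hu : is_ghom u) : ghom_type :=
  @GHom u (asboolT hu).

Lemma is_ghomP (u : ghom_type) : is_ghom u.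
Proof. by case: u => u /= /asboolP. Qed.

Definition ghom_homog (g : G) : set ghom_type := fun u => hom_shift g u.

Lemma ghom_homog0 g : ghom_homog g 0.
Proof. exact: hom_shift0. Qed.
Lemma ghom_homogB g (u v : ghom_type) :
  ghom_homog g u -> ghom_homog g v -> ghom_homog g (u - v).
Proof. by move=> hu /hom_shiftN; apply: hom_shiftD. Qed.

Lemma ghom_span (u : ghom_type) : exists s : seq G, exists2 f : G -> ghom_type,
  uniq s /\ (forall g, ghom_homog g (f g)) & u = \sum_(g <- s) f g.
Proof.
have [s [f [us hf] e]] := is_ghomP u.
exists s, (fun g => ghom_of (is_ghom_shift (hf g))) => //.
by apply: val_inj; rewrite raddf_sum.
Qed.

Lemma ghom_direct (s : seq G) (f : G -> ghom_type) :
  uniq s -> (forall g, ghom_homog g (f g)) -> \sum_(g <- s) f g = 0 ->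
  forall g, g \in s -> f g = 0.
Proof.
move=> us hf e g gs; apply: val_inj; apply/funext => x.
have [v ev] := hf g; suff : f g x = 0 by [].
elim/(homog_ind (A := gmod_deg M)): x => [|x y|a x hx].
- by rewrite ev linear0.
- by rewrite ev linearD => -> ->; rewrite addr0.
apply: (@homog_direct _ _ (shift_deg N a) s (fun g => f g x) us) => // [g'|].
  by rewrite /= addrC; apply: hom_shift_deg hx; apply: hf.
have : (val (\sum_(g <- s) f g)) x = 0 by rewrite e.
by rewrite raddf_sum fct_sumE.
Qed.

Definition ghom_deg : grading G ghom_type :=
  Grading ghom_homog0 ghom_homogB ghom_span ghom_direct.

Lemma ghom_degZ g g' (r : R) (u : ghom_type) :
  gring_deg R g r -> ghom_deg g' u -> ghom_deg (g + g') (r *: u).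
Proof. exact: hom_shiftZ. Qed.

Definition ghom : gmod R := @GMod G R ghom_type ghom_deg ghom_degZ.
End GHom.

(* -------------------------------------------------------------------- *)
(* Coextension of scalars: Hom^G_R(h_*(S), M), with (s u)(t) = u(s t) *)
Definition coext_type (G : zmodType) (R S : gring G) (h : gring_hom R S)
  (M : gmod R) : Type := ghom_type (gres h (greg S)) M.

Section Coext.
Variables (G : zmodType) (R S : gring G) (h : gring_hom R S) (M : gmod R).
Local Notation hS := (gres h (greg S)).
HB.instance Definition _ := GRing.Zmodule.on (coext_type h M).

Definition coext_fun (s : S) (u : hS -> M) : hS -> M :=
  fun t : S => u (s * t).

Lemma coext_fun_shift g g' s u : gring_deg S g s -> hom_shift g' u ->
  hom_shift (g + g') (coext_fun s u).
Proof.
move=> hs hu; apply: hom_shiftP => [a x y|a x hx].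
  have -> : coext_fun s u (a *: x + y) =
      u (a *: (s * (x : S) : hS) + (s * (y : S) : hS)).
    by congr u; apply: etrans (mulrDr _ _ _) _; congr (_ + _); apply: mulrCA.
  exact: (hom_shift_linear hu).
rewrite addrAC [_ + a]addrC addrC; apply: hom_shift_deg hu _.
by rewrite addrC; apply: gring_degM.
Qed.

Lemma is_ghom_coext s u : is_ghom u -> is_ghom (coext_fun s u).
Proof.
move=> hu; elim/(homog_ind (A := gring_deg S)): s => [|s s' hs hs'|g s hs].
- have -> : coext_fun 0 u = 0; last exact: is_ghom0.
  apply/funext => t; suff : u (0 * (t : S)) = 0 by [].
  by rewrite mul0r; apply: (addrI (u 0)); rewrite -(is_ghom_add _ _ hu) !addr0.
- have -> : coext_fun (s + s') u = coext_fun s u + coext_fun s' u.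
    apply/funext => t; suff : u ((s + s') * (t : S)) = u (s * (t : S)) + u (s' * (t : S)) by [].
    by rewrite mulrDl; apply: is_ghom_add hu.
  exact: is_ghomD.
- case: hu => l [f [_ hf] ->].
  have -> : coext_fun s (\sum_(a <- l) f a) = \sum_(a <- l) coext_fun s (f a).
    by rewrite /coext_fun !fct_sumE.
  apply: is_ghom_sum => a; exists (g + a); exact: coext_fun_shift.
Qed.

Definition coext_scale (s : S) (u : coext_type h M) : coext_type h M :=
  ghom_of (is_ghom_coext s (is_ghomP u)).

Fact coext_scaleA a b u : coext_scale a (coext_scale b u) = coext_scale (a * b) u.
Proof.
apply: val_inj; apply/funext => t; congr (ghom_fun u _).
by rewrite mulrCA mulrA.
Qed.
Fact coext_scale1 : left_id 1 coext_scale.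
Proof.
move=> u; apply: val_inj; apply/funext => t; congr (ghom_fun u _).
exact: mul1r.
Qed.
Fact coext_scaleDr : right_distributive coext_scale +%R.
Proof. by move=> a u v; apply: val_inj; apply/funext. Qed.
Fact coext_scaleDl u : {morph coext_scale^~ u : a b / a + b}.
Proof.
move=> a b; apply: val_inj; apply/funext => t.
apply: etrans (is_ghom_add _ _ (is_ghomP u)); congr (ghom_fun u _).
exact: mulrDl.
Qed.

HB.instance Definition _ := GRing.Zmodule_isLmodule.Build S (coext_type h M)
  coext_scaleA coext_scale1 coext_scaleDr coext_scaleDl.

(* same grading as [ghom (gres h (greg S)) M] *)
Definition coext_deg : grading G (coext_type h M) :=
  let A := ghom_deg hS M in
  @Grading G (coext_type h M) A (homog0 A) (@homogB _ _ A)
    (@homog_span _ _ A) (@homog_direct _ _ A).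

Lemma coext_degZ g g' (s : S) (u : coext_type h M) :
  gring_deg S g s -> coext_deg g' u -> coext_deg (g + g') (s *: u).
Proof. exact: coext_fun_shift. Qed.

Definition gcoext : gmod S := @GMod G S (coext_type h M) coext_deg coext_degZ.
End Coext.

(* -------------------------------------------------------------------- *)
Section Sigma.
Variables (G : zmodType) (R S : gring G) (h : gring_hom R S) (N : gmod S).
Local Notation hS := (res_type h S^o).
Local Notation hN := (res_type h N).

(* s (x) x |-> s x *)
Definition sigma_fun : gext h (gres h N) -> N :=
  tensor_lift (fun (s : hS) (x : hN) => (s : S) *: (x : N)).

Lemma sigma_balanced : balanced (fun (s : hS) (x : hN) => (s : S) *: (x : N)).
Proof.
split=> [s s' x|s x x'|r s x]; [exact: scalerDl|exact: scalerDr|].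
rewrite [RHS]scalerA mulrC; congr (_ *: _); exact: mulrC.
Qed.

Lemma sigma_fun_tens (s : hS) (x : hN) : sigma_fun (tens s x) = (s : S) *: (x : N).
Proof. exact: (tensor_lift_tens sigma_balanced). Qed.

Let sigma_funD t u : sigma_fun (t + u) = sigma_fun t + sigma_fun u.
Proof. exact: (tensor_liftD sigma_balanced). Qed.
Let sigma_fun0 : sigma_fun 0 = 0.
Proof. exact: (tensor_lift0 sigma_balanced). Qed.

Fact sigma_lin : linear sigma_fun.
Proof.
move=> s t u; rewrite sigma_funD; congr (_ + _).
elim/tensor_ind: t => [|a x|t t' e e'].
- by rewrite scaler0 sigma_fun0 scaler0.
- rewrite [s *: _]ext_scale_tens !sigma_fun_tens; exact/esym/scalerA.
- by rewrite scalerDr !sigma_funD e e' scalerDr.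
Qed.

Fact sigma_deg g t : gmod_deg (gext h (gres h N)) g t -> gmod_deg N g (sigma_fun t).
Proof.
move=> [l -> hl]; rewrite [sigma_fun _](tensor_lift_sum sigma_balanced).
apply: homog_sum => p /hl [a [b [ha hb <-]]].
by rewrite (tensor_lift_tens sigma_balanced); apply: gmod_degZ.
Qed.

Definition sigma_hom : gmod_hom (gext h (gres h N)) N :=
  mk_gmod_hom sigma_lin sigma_deg.
End Sigma.

Section Rho.
Variables (G : zmodType) (R S : gring G) (h : gring_hom R S) (N : gmod S).
Local Notation hS := (gres h (greg S)).

(* s |-> s x *)
Definition rho_map (x : N) : hS -> gres h N := fun s : S => s *: x.

Lemma rho_map_shift g (x : N) : gmod_deg N g x -> hom_shift g (rho_map x).
Proof.
move=> hx; apply: hom_shiftP => [a s s'|a s hs].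
  have key (b t t' : S) : (b * t + t') *: x = b *: (t *: x) + t' *: x.
    by rewrite scalerDl scalerA.
  exact: key.
by rewrite addrC; apply: (gmod_degZ (g := a) (r := (s : S)) hs hx).
Qed.

Lemma is_ghom_rho (x : N) : is_ghom (rho_map x).
Proof.
elim/(homog_ind (A := gmod_deg N)): x => [|x y hx hy|g x hx].
- have -> : rho_map 0 = 0; last exact: is_ghom0.
  by apply/funext => s; exact: (@scaler0 S N s).
- have -> : rho_map (x + y) = rho_map x + rho_map y; last exact: is_ghomD.
  by apply/funext => s; exact: (@scalerDr S N s x y).
- exact: is_ghom_shift (rho_map_shift hx).
Qed.

Definition rho_fun (x : N) : gcoext h (gres h N) := ghom_of (is_ghom_rho x).

Fact rho_lin : linear rho_fun.
Proof.
have key (a b : S) (x y : N) : b *: (a *: x + y) = (a * b) *: x + b *: y.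
  by rewrite scalerDr scalerA mulrC.
by move=> s x y; apply: val_inj; apply/funext => t; apply: key.
Qed.

Fact rho_deg g x : gmod_deg N g x -> gmod_deg (gcoext h (gres h N)) g (rho_fun x).
Proof. exact: rho_map_shift. Qed.

Definition rho_hom : gmod_hom N (gcoext h (gres h N)) := mk_gmod_hom rho_lin rho_deg.
End Rho.

Section Gamma.
Variables (G : zmodType) (R S : gring G) (h : gring_hom R S) (M N : gmod S).
Local Notation hM := (res_type h M).
Local Notation hN := (res_type h N).

(* x (x) y |-> x (x) y *)
Definition gamma_fun :
    gtensor (gres h M) (gres h N) -> gres h (gtensor M N) :=
  tensor_lift (fun (x : hM) (y : hN) => tens (x : M) (y : N)).

Lemma gamma_balanced : balanced (fun (x : hM) (y : hN) => tens (x : M) (y : N)).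
Proof.
split=> [x x' y|x y y'|r x y]; [exact: tensDl|exact: tensDr|exact: tensZ].
Qed.

Lemma gamma_fun_tens (x : hM) (y : hN) :
  gamma_fun (tens x y) = tens (x : M) (y : N).
Proof. exact: (tensor_lift_tens gamma_balanced). Qed.

Let gamma_funD t u : gamma_fun (t + u) = gamma_fun t + gamma_fun u.
Proof. exact: (tensor_liftD gamma_balanced). Qed.
Let gamma_fun0 : gamma_fun 0 = 0.
Proof. exact: (tensor_lift0 gamma_balanced). Qed.

Fact gamma_lin : linear gamma_fun.
Proof.
move=> r t u; rewrite gamma_funD; congr (_ + _).
elim/tensor_ind: t => [|a x|t t' e e'].
- by rewrite scaler0 gamma_fun0 scaler0.
- rewrite tensor_scale_tens !gamma_fun_tens; exact/esym/tensor_scale_tens.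
- by rewrite scalerDr !gamma_funD e e' scalerDr.
Qed.

Fact gamma_deg g t : gmod_deg (gtensor (gres h M) (gres h N)) g t ->
  gmod_deg (gres h (gtensor M N)) g (gamma_fun t).
Proof.
move=> [l -> hl]; rewrite [gamma_fun _](tensor_lift_sum gamma_balanced).
apply: (homog_sum (A := tensor_deg M N)) => p /hl [a [b [ha hb <-]]].
by rewrite (tensor_lift_tens gamma_balanced); apply: tensor_homog_tens.
Qed.

Definition gamma_hom :
    gmod_hom (gtensor (gres h M) (gres h N)) (gres h (gtensor M N)) :=
  mk_gmod_hom gamma_lin gamma_deg.
End Gamma.

Section Eta.
Variables (G : zmodType) (R S : gring G) (h : gring_hom R S) (M N : gmod S).

Lemma res_hom_shift g (u : M -> N) :
  hom_shift g u -> hom_shift g (u : gres h M -> gres h N).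
Proof.
move=> hu; apply: hom_shiftP => [a x y|a x hx].
  exact: (hom_shift_linear hu).
exact: (hom_shift_deg hu).
Qed.

Lemma res_is_ghom (u : M -> N) :
  is_ghom u -> is_ghom (u : gres h M -> gres h N).
Proof.
by move=> [l [f [ul hf] e]]; exists l, f => //; split=> // g; apply: res_hom_shift.
Qed.

(* u, regarded as an R-linear map *)
Definition eta_fun (u : gres h (ghom M N)) : ghom (gres h M) (gres h N) :=
  ghom_of (res_is_ghom (is_ghomP (u : ghom_type M N))).

Fact eta_lin : linear eta_fun.
Proof. by move=> r u v; apply: val_inj; apply/funext. Qed.

Fact eta_deg g u : gmod_deg (gres h (ghom M N)) g u ->
  gmod_deg (ghom (gres h M) (gres h N)) g (eta_fun u).
Proof. exact: res_hom_shift. Qed.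

Definition eta_hom : gmod_hom (gres h (ghom M N)) (ghom (gres h M) (gres h N)) :=
  mk_gmod_hom eta_lin eta_deg.
End Eta.

Section NaturalMaps.
Variables (G : zmodType) (R S : gring G) (h : gring_hom R S).

Lemma sigma_homE (N : gmod S) (s : S) (x : N) :
  sigma_hom h N (tens (s : res_type h S^o) (x : res_type h N)) = s *: x.
Proof. exact: sigma_fun_tens. Qed.

Lemma rho_homE (N : gmod S) (x : N) (s : S) :
  ghom_fun (rho_hom h N x) s = s *: x.
Proof. by []. Qed.

Lemma gamma_homE (M N : gmod S) (x : M) (y : N) :
  gamma_hom h M N (tens (x : res_type h M) (y : res_type h N)) = tens x y.
Proof. exact: gamma_fun_tens. Qed.

Lemma eta_homE (M N : gmod S) (u : ghom M N) (x : M) :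
  ghom_fun (eta_hom h M N u) x = ghom_fun u x.
Proof. by []. Qed.

Lemma gres_scaleE (N : gmod S) (r : R) (x : N) :
  r *: (x : gres h N) = h r *: x.
Proof. by []. Qed.

Lemma gext_scaleE (M : gmod R) (s t : S) (x : M) :
  s *: (tens (t : res_type h S^o) x : gext h M) = tens (s * t : res_type h S^o) x.
Proof. exact: ext_scale_tens. Qed.

Lemma gcoext_scaleE (M : gmod R) (s t : S) (u : gcoext h M) :
  ghom_fun (s *: u) t = ghom_fun u (s * t).
Proof. by []. Qed.
End NaturalMaps.

(* Main.v *)
(* All conditions are equivalent to the identity s ⊗ 1 = 1 ⊗ s in S ⊗_R S.
   Applying an R-balanced map F to it gives F s 1 = F 1 s, so that the identity
   makes every R-linear map of S-modules S-linear and every R-balanced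
   (a, b) |-> (a x) ⊗ (b y) S-balanced. Conversely it says that the two maps
   from S to the graded ring S ⊗_R S agree, that the R-linear map
   s |-> 1 ⊗ s is S-linear for the action on the left factor, and that two
   elements with the same image under σ_S (or γ_{S,S}) are equal. *)
Require Import Defs.
From HB Require Import structures.
From mathcomp Require Import all_boot ssralg.
From mathcomp Require Import boolp.

Set Implicit Arguments.
Unset Strict Implicit.
Unset Printing Implicit Defensive.

Import GRing.Theory.
Local Open Scope ring_scope.

(** * Homogeneous components and isomorphisms in [Mod^G(R)] *)

Section GradedMorphisms.
Variables (G : zmodType) (R : gring G) (M N : gmod R) (f : gmod_hom M N).

(** The images of the components of [x] are homogeneous of the same degrees and sum to [f x], so
    uniqueness of the decomposition applies. *)
Lemma hcomp_gmod_hom x g :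
  hcomp (gmod_deg N) (f x) g = f (hcomp (gmod_deg M) x g).
Proof.
have -> // : hcomp (gmod_deg N) (f x) = f \o hcomp (gmod_deg M) x.
apply: (hcomp_unique (hsupp_uniq (gmod_deg M) x)) => [a|a /hcomp_notin_hsupp e|].
- exact/gmod_fun_deg/hcomp_homog.
- by rewrite /= e linear0.
- by rewrite {1}(hcomp_sum (gmod_deg M) x) linear_sum.
Qed.

(** Since [f x] is its own component of degree [g], it is the image of the component of [x] of
    degree [g]; injectivity identifies the two. *)
Lemma gmod_hom_reflects_deg g x :
  injective f -> gmod_deg N g (f x) -> gmod_deg M g x.
Proof.
move=> f_inj hfx; have -> : x = hcomp (gmod_deg M) x g; last exact: hcomp_homog.
by apply: f_inj; rewrite -hcomp_gmod_hom (hcomp_homogE hfx) eqxx.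
Qed.

(** Linearity and degree preservation of the inverse are automatic, so each isomorphism below needs
    only an inverse map of sets. *)
Lemma gmod_iso_of_cancel (f' : N -> M) : cancel f f' -> cancel f' f -> gmod_iso f.
Proof.
move=> fK f'K; have f_inj := can_inj fK.
have f'_lin : linear f' by move=> a x y; apply: f_inj; rewrite linearP !f'K.
have f'_deg g y : gmod_deg N g y -> gmod_deg M g (f' y).
  by move=> hy; apply: (gmod_hom_reflects_deg f_inj); rewrite f'K.
by exists (mk_gmod_hom f'_lin f'_deg).
Qed.

Lemma gmod_iso_inj : gmod_iso f -> injective f.
Proof. by case=> f' /can_inj. Qed.

End GradedMorphisms.

Lemma linear_greg (G : zmodType) (S : gring G) (N : gmod S) (u : greg S -> N) :
  linear u -> forall s : S, u s = s *: u (1 : S).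
Proof.
move=> /scalable_linear uZ s; rewrite -uZ; congr u; exact/esym/mulr1.
Qed.

(** * The ring structure on A ⊗_R B *)

Section TensorRing.
Variables (R A B : comPzRingType) (f : {rmorphism R -> A}) (g : {rmorphism R -> B}).
Local Notation fA := (res_type f A^o).
Local Notation gB := (res_type g B^o).

(** A separate name, so that the product is attached to tensor products of algebras only. *)
Definition tensor_ring : Type := tensor fA gB.
HB.instance Definition _ := GRing.Zmodule.on tensor_ring.

Definition tensR (a : A) (b : B) : tensor_ring := tens (a : fA) (b : gB).

(** Multiplication by the pure tensor a ⊗ b. The product is built by two successive lifts, and this
    is the one in the right factor. *)
Definition tensor_shear (a : A) (b : B) : tensor_ring -> tensor_ring :=
  tensor_lift (fun (x : fA) (y : gB) => tensR (a * (x : A)) (b * (y : B))).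

Lemma tensRDl a a' b : tensR (a + a') b = tensR a b + tensR a' b.
Proof. exact: tensDl. Qed.
Lemma tensRDr a b b' : tensR a (b + b') = tensR a b + tensR a b'.
Proof. exact: tensDr. Qed.
Lemma tensRZ r a b : tensR (f r * a) b = tensR a (g r * b).
Proof. exact: (@tensZ R fA gB r a b). Qed.

Lemma tensor_ring_ind (P : tensor_ring -> Prop) : P 0 ->
  (forall a b, P (tensR a b)) -> (forall t u, P t -> P u -> P (t + u)) ->
  forall t, P t.
Proof. exact: (@tensor_ind R fA gB P). Qed.

Lemma shear_balanced a b :
  balanced (fun (x : fA) (y : gB) => tensR (a * (x : A)) (b * (y : B))).
Proof.
split=> [x x' y|x y y'|r x y].
- by rewrite -tensRDl -mulrDr.
- by rewrite -tensRDr -mulrDr.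
- rewrite [_ *: x]/(f r * (x : A)) [_ *: y]/(g r * (y : B)).
  by rewrite mulrCA tensRZ mulrCA.
Qed.

Lemma tensor_shear_tens a b x y :
  tensor_shear a b (tensR x y) = tensR (a * x) (b * y).
Proof. exact: (tensor_lift_tens (shear_balanced a b)). Qed.
Lemma tensor_shear0 a b : tensor_shear a b 0 = 0.
Proof. exact: (tensor_lift0 (shear_balanced a b)). Qed.
Lemma tensor_shearD a b t u :
  tensor_shear a b (t + u) = tensor_shear a b t + tensor_shear a b u.
Proof. exact: (tensor_liftD (shear_balanced a b)). Qed.

Definition tensor_mul (t u : tensor_ring) : tensor_ring :=
  tensor_lift (fun (a : fA) (b : gB) => tensor_shear a b u) t.

Lemma tensor_mul_balanced u :
  balanced (fun (a : fA) (b : gB) => tensor_shear a b u).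
Proof.
split=> [a a' b|a b b'|r a b]; elim/tensor_ring_ind: u => [|x y|t u et eu].
- by rewrite !tensor_shear0 addr0.
- by rewrite !tensor_shear_tens mulrDl tensRDl.
- by rewrite !tensor_shearD et eu addrACA.
- by rewrite !tensor_shear0 addr0.
- by rewrite !tensor_shear_tens mulrDl tensRDr.
- by rewrite !tensor_shearD et eu addrACA.
- by rewrite !tensor_shear0.
- rewrite !tensor_shear_tens [_ *: a]/(f r * (a : A)) [_ *: b]/(g r * (b : B)).
  by rewrite -!mulrA tensRZ.
- by rewrite !tensor_shearD et eu.
Qed.

Lemma tensor_mul_tensl a b u : tensor_mul (tensR a b) u = tensor_shear a b u.
Proof. exact: (tensor_lift_tens (tensor_mul_balanced u)). Qed.
Lemma tensor_mul_tens a b x y :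
  tensor_mul (tensR a b) (tensR x y) = tensR (a * x) (b * y).
Proof. by rewrite tensor_mul_tensl tensor_shear_tens. Qed.

Fact tensor_mulDl : left_distributive tensor_mul +%R.
Proof. by move=> t u v; apply: (tensor_liftD (tensor_mul_balanced v)). Qed.
Fact tensor_mul0l : left_zero 0 tensor_mul.
Proof. by move=> v; apply: (tensor_lift0 (tensor_mul_balanced v)). Qed.

Fact tensor_mulC : commutative tensor_mul.
Proof.
move=> t u; elim/tensor_ring_ind: t => [|a b|t t' et et'].
- elim/tensor_ring_ind: u => [//|a b|u u' e e'].
    by rewrite tensor_mul_tensl tensor_shear0 tensor_mul0l.
  by rewrite tensor_mulDl -e -e' !tensor_mul0l addr0.
- elim/tensor_ring_ind: u => [|x y|u u' e e'].
  + by rewrite tensor_mul_tensl tensor_shear0 tensor_mul0l.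
  + by rewrite !tensor_mul_tens mulrC [b * y]mulrC.
  + by rewrite tensor_mulDl -e -e' !tensor_mul_tensl tensor_shearD.
- rewrite tensor_mulDl et et' {et et'}.
  (* What remains is additivity of the product in its right factor; for pure [u] it is additivity of
     [tensor_shear]. *)
  elim/tensor_ring_ind: u => [|x y|u u' e e'].
  + by rewrite !tensor_mul0l addr0.
  + by rewrite !tensor_mul_tensl tensor_shearD.
  + by rewrite !tensor_mulDl -e -e' addrACA.
Qed.

Fact tensor_mulA : associative tensor_mul.
Proof.
(* Commutativity carries the rules for the left factor over to the right one, so that induction on
   all three factors leaves only pure tensors. *)
have mulDr t u v : tensor_mul t (u + v) = tensor_mul t u + tensor_mul t v.
  by rewrite tensor_mulC tensor_mulDl !(tensor_mulC t).
have mul0r t : tensor_mul t 0 = 0 by rewrite tensor_mulC tensor_mul0l.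
move=> t u v.
elim/tensor_ring_ind: t => [|a b|t t' e e']; first by rewrite !tensor_mul0l.
  elim/tensor_ring_ind: u => [|c d|u u' e e'].
  - by rewrite !(mul0r, tensor_mul0l).
  - elim/tensor_ring_ind: v => [|x y|v v' e e']; first by rewrite !mul0r.
      by rewrite !tensor_mul_tens !mulrA.
    by rewrite !mulDr e e'.
  - by rewrite tensor_mulDl !mulDr tensor_mulDl e e'.
by rewrite !tensor_mulDl e e'.
Qed.

Fact tensor_mul1 : left_id (tensR 1 1) tensor_mul.
Proof.
move=> t; elim/tensor_ring_ind: t => [|a b|t u et eu].
- by rewrite tensor_mulC tensor_mul0l.
- by rewrite tensor_mul_tens !mul1r.
- by rewrite tensor_mulC tensor_mulDl !(tensor_mulC _ (tensR 1 1)) et eu.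
Qed.

HB.instance Definition _ := GRing.Zmodule_isComPzRing.Build tensor_ring
  tensor_mulA tensor_mulC tensor_mul1 tensor_mulDl.

Lemma tensRM a b x y : tensR a b * tensR x y = tensR (a * x) (b * y).
Proof. exact: tensor_mul_tens. Qed.

Definition tensor_inl (a : A) : tensor_ring := tensR a 1.
Definition tensor_inr (b : B) : tensor_ring := tensR 1 b.

Fact tensor_inl_zmod : zmod_morphism tensor_inl.
Proof.
move=> a a'; apply/eqP; rewrite eq_sym subr_eq /tensor_inl -tensRDl.
by rewrite subrK.
Qed.
Fact tensor_inl_monoid : monoid_morphism tensor_inl.
Proof. by split=> // a a'; rewrite /tensor_inl tensRM mul1r. Qed.
Fact tensor_inr_zmod : zmod_morphism tensor_inr.
Proof.
move=> b b'; apply/eqP; rewrite eq_sym subr_eq /tensor_inr -tensRDr.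
by rewrite subrK.
Qed.
Fact tensor_inr_monoid : monoid_morphism tensor_inr.
Proof. by split=> // b b'; rewrite /tensor_inr tensRM mul1r. Qed.

HB.instance Definition _ :=
  GRing.isZmodMorphism.Build A tensor_ring tensor_inl tensor_inl_zmod.
HB.instance Definition _ :=
  GRing.isMonoidMorphism.Build A tensor_ring tensor_inl tensor_inl_monoid.
HB.instance Definition _ :=
  GRing.isZmodMorphism.Build B tensor_ring tensor_inr tensor_inr_zmod.
HB.instance Definition _ :=
  GRing.isMonoidMorphism.Build B tensor_ring tensor_inr tensor_inr_monoid.

End TensorRing.

(** * A ⊗_R B as a graded ring, with its two inclusions *)

Section GradedTensorRing.
Variables (G : zmodType) (R A B : gring G) (f : gring_hom R A) (g : gring_hom R B).
Local Notation T := (tensor_ring f g).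
Local Notation MA := (gres f (greg A)).
Local Notation MB := (gres g (greg B)).

Definition tensor_ring_deg : grading G T :=
  let D := tensor_deg MA MB in
  @Grading G T D (homog0 D) (@homogB _ _ D) (@homog_span _ _ D)
    (@homog_direct _ _ D).

Lemma tensor_ring_deg_tens a b (x : A) (y : B) :
  gring_deg A a x -> gring_deg B b y -> tensor_ring_deg (a + b) (tensR f g x y).
Proof. exact: (@tensor_homog_tens G R MA MB a b x y). Qed.

Lemma tensor_ring_deg1 : tensor_ring_deg 0 1.
Proof. by rewrite -[0]addr0; apply: tensor_ring_deg_tens; apply: gring_deg1. Qed.

Lemma tensor_ring_degM k k' t u : tensor_ring_deg k t -> tensor_ring_deg k' u ->
  tensor_ring_deg (k + k') (t * u).
Proof.
move=> [l -> hl] [l' -> hl'].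
rewrite [_ * _](@mulr_suml T); apply: homog_sum => p /hl [a [b [ha hb <-]]].
rewrite [_ * _](@mulr_sumr T); apply: homog_sum => q /hl' [c [d [hc hd <-]]].
rewrite [_ * _]tensRM addrACA.
by apply: tensor_ring_deg_tens; apply: gring_degM.
Qed.

Definition gtensor_ring : gring G :=
  @GRing G T tensor_ring_deg tensor_ring_deg1 tensor_ring_degM.

Definition gtensor_inl : gring_hom A gtensor_ring.
Proof.
apply: (@GRingHom G A gtensor_ring (tensor_inl f g)) => a x hx.
by rewrite -[a]addr0; apply: tensor_ring_deg_tens => //; apply: gring_deg1.
Defined.

Definition gtensor_inr : gring_hom B gtensor_ring.
Proof.
apply: (@GRingHom G B gtensor_ring (tensor_inr f g)) => b y hy.
by rewrite -[b]add0r; apply: tensor_ring_deg_tens => //; apply: gring_deg1.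
Defined.

(** The balancing relation at 1 ⊗ 1. For A = B = S it makes the two inclusions a test pair for
    [gring_epi]. *)
Lemma gtensor_inl_inr r : gtensor_inl (f r) = gtensor_inr (g r).
Proof.
by have := tensRZ f g r 1 1; rewrite !mulr1.
Qed.

End GradedTensorRing.

(** * The identity s ⊗ 1 = 1 ⊗ s compared with each condition *)

Section TensSymmetric.
Variables (G : zmodType) (R S : gring G) (h : gring_hom R S).
Local Notation hS := (res_type h S^o).

Definition tens_symmetric : Prop :=
  forall s : S, tensR h h s 1 = tensR h h 1 s.

(** The map induced by [F] on S ⊗_R S is applied to the identity. Most consequences below come from
    a suitable choice of [F]. *)
Lemma tens_symmetric_balanced (Z : zmodType) (F : hS -> hS -> Z) (s : S) :
  tens_symmetric -> balanced F -> F s (1 : S) = F (1 : S) s.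
Proof.
move=> sym FB; rewrite -!(tensor_lift_tens FB).
exact: (congr1 (@tensor_lift R hS hS Z F) (sym s)).
Qed.

Lemma epi_tens_symmetric : gring_epi h -> tens_symmetric.
Proof.
move=> epi s; apply: (epi _ (gtensor_inl h h) (gtensor_inr h h)) => r.
exact: gtensor_inl_inr.
Qed.

Lemma tens_symmetric_epi : tens_symmetric -> gring_epi h.
Proof.
move=> sym T f f' eff' s.
(* Balanced because [f] and [f'] agree on the image of [h]; its values at (s, 1) and (1, s) are
   [f s] and [f' s]. *)
have FB : balanced (fun a b : hS => f a * f' b).
  split=> [a a' b|a b b'|r a b].
  - by rewrite -mulrDl -rmorphD.
  - by rewrite -mulrDr -rmorphD.
  - rewrite [_ *: a]/(h r * (a : S)) [_ *: b]/(h r * (b : S)) !rmorphM.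
    by have /= -> := eff' r; rewrite mulrCA mulrA.
by have := tens_symmetric_balanced s sym FB; rewrite !rmorph1 mulr1 mul1r.
Qed.

(** Both s ⊗ 1 and 1 ⊗ s are sent to [s]. *)
Lemma sigma_tens_symmetric :
  injective (sigma_hom h (greg S)) -> tens_symmetric.
Proof.
move=> inj s; apply: inj; rewrite !sigma_homE.
exact: etrans (mulr1 s) (esym (mul1r s)).
Qed.

(** Take F(a, b) = a ⊗ b x: scalars from S, not only from R, cross the tensor sign. *)
Lemma tens_symmetric_res (N : gmod S) (s : S) (x : N) : tens_symmetric ->
  tens (s : hS) (x : res_type h N) = tens ((1 : S) : hS) (s *: x : res_type h N).
Proof.
move=> sym.
have FB : balanced (fun a b : hS => tens a ((b : S) *: x : res_type h N)).
  split=> [a a' b|a b b'|r a b].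
  - exact: tensDl.
  - by rewrite -tensDr [in LHS]scalerDl.
  - by rewrite tensZ; congr (tens _ _); apply: (@scalerA S N).
by rewrite -(tens_symmetric_balanced s sym FB) scale1r.
Qed.

Lemma tens_symmetric_sigma (N : gmod S) :
  tens_symmetric -> gmod_iso (sigma_hom h N).
Proof.
move=> sym.
(* The inverse x ↦ 1 ⊗ x; it is a left inverse because s ⊗ x = 1 ⊗ s x. *)
pose f' (x : N) : gext h (gres h N) := tens ((1 : S) : hS) (x : res_type h N).
apply: (gmod_iso_of_cancel (f' := f')) => [t|x]; last by rewrite sigma_homE scale1r.
elim/tensor_ind: t => [|s x|t u et eu].
- by rewrite linear0; apply: tens0r.
- by rewrite sigma_homE /f' -tens_symmetric_res.
- by rewrite linearD -[in RHS]et -[in RHS]eu; apply: tensDr.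
Qed.

Lemma tens_symmetric_linear (M N : gmod S) (u : gres h M -> gres h N) :
  tens_symmetric -> linear u -> linear (u : M -> N).
Proof.
move=> sym u_lin.
have uD x y : u (x + y) = u x + u y by have := u_lin 1 x y; rewrite !scale1r.
have uZ : scalable u := scalable_linear u_lin.
move=> s x y; rewrite [LHS]uD; congr (_ + _).
(* With F(a, b) = a u(b x), the values at (s, 1) and (1, s) are s u(x) and u(s x). *)
have FB : balanced (fun a b : hS => (a : S) *: (u ((b : S) *: (x : M)) : N)).
  split=> [a a' b|a b b'|r a b].
  - exact: scalerDl.
  - rewrite -[RHS]scalerDr; congr (_ *: _); apply: etrans (uD _ _); congr u.
    exact: (@scalerDl S M x b b').
  - have swap (c d : S) (z : N) : (c * d) *: z = d *: (c *: z).
      by rewrite scalerA mulrC.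
    apply: etrans (swap (h r) a _) _; congr (_ *: _).
    apply: etrans (esym (uZ _ _)) _; congr u; exact: (@scalerA S M).
by have := tens_symmetric_balanced s sym FB; rewrite !scale1r => ->.
Qed.

Lemma tens_symmetric_hom_shift (M N : gmod S) g (u : M -> N) : tens_symmetric ->
  hom_shift g (u : gres h M -> gres h N) -> hom_shift g u.
Proof.
move=> sym hu; apply: hom_shiftP => [|a x hx].
  exact: (tens_symmetric_linear sym (hom_shift_linear hu)).
exact: (hom_shift_deg hu).
Qed.

Lemma tens_symmetric_is_ghom (M N : gmod S) (u : M -> N) : tens_symmetric ->
  is_ghom (u : gres h M -> gres h N) -> is_ghom u.
Proof.
move=> sym [l [f [ul hf] e]]; exists l, f => //; split=> // g.
exact: tens_symmetric_hom_shift.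
Qed.

Lemma tens_symmetric_eta (M N : gmod S) :
  tens_symmetric -> gmod_iso (eta_hom h M N).
Proof.
move=> sym.
pose f' (u : ghom (gres h M) (gres h N)) : gres h (ghom M N) :=
  ghom_of (tens_symmetric_is_ghom sym (is_ghomP u)).
by apply: (gmod_iso_of_cancel (f' := f')) => u; apply: val_inj.
Qed.

Lemma tens_symmetric_rho (N : gmod S) :
  tens_symmetric -> gmod_iso (rho_hom h N).
Proof.
move=> sym.
(* The inverse is evaluation at 1: [u] turns out to be S-linear, hence determined by u(1). *)
pose f' (u : gcoext h (gres h N)) : N := ghom_fun u (1 : S).
apply: (gmod_iso_of_cancel (f' := f')) => [x|u]; first exact: scale1r.
apply: val_inj; apply/funext => s.
have u_lin := tens_symmetric_linear (M := greg S) sym (is_ghom_linear (is_ghomP u)).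
exact/esym/(linear_greg u_lin).
Qed.

Lemma tens_symmetric_gamma (M N : gmod S) :
  tens_symmetric -> gmod_iso (gamma_hom h M N).
Proof.
move=> sym; pose c (x : M) (y : N) := tens (x : res_type h M) (y : res_type h N).
have cB : balanced c.
  split=> [x x' y|x y y'|s x y]; [exact: tensDl|exact: tensDr|].
  (* For fixed [x] and [y] this gives s x ⊗ y = x ⊗ s y over R, so [c] is S-balanced and descends to
     M ⊗_S N, where it inverts γ. *)
  have FB : balanced (fun a b : hS => c ((a : S) *: x) ((b : S) *: y)).
    split=> [a a' b|a b b'|r a b].
    - by rewrite /c -tensDl [in LHS]scalerDl.
    - by rewrite /c -tensDr [in LHS]scalerDl.
    - rewrite /c -[X in tens X _ = _](@scalerA S M (h r)).
      rewrite -[X in _ = tens _ X](@scalerA S N (h r)); exact: tensZ.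
  by have := tens_symmetric_balanced s sym FB; rewrite !scale1r.
pose f' : gres h (gtensor M N) -> gtensor (gres h M) (gres h N) :=
  @tensor_lift S M N _ c.
have f'_tens x y : f' (tens x y) = c x y := tensor_lift_tens cB x y.
have f'0 : f' 0 = 0 := tensor_lift0 cB.
have f'D t u : f' (t + u) = f' t + f' u := tensor_liftD cB t u.
apply: (gmod_iso_of_cancel (f' := f')) => t.
  elim/tensor_ind: t => [|x y|t u et eu].
  - by rewrite linear0 f'0.
  - by rewrite gamma_homE f'_tens.
  - by rewrite linearD f'D et eu.
elim/tensor_ind: t => [|x y|t u et eu].
- by rewrite f'0 linear0.
- by rewrite f'_tens gamma_homE.
- by rewrite f'D linearD et eu.
Qed.

(** The images of s ⊗ 1 and 1 ⊗ s coincide in S ⊗_S S. *)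
Lemma gamma_tens_symmetric :
  injective (gamma_hom h (greg S) (greg S)) -> tens_symmetric.
Proof.
move=> inj s; apply: inj; rewrite !gamma_homE.
have := @tensZ S S^o S^o s 1 1.
by rewrite ![_ *: _]mulr1.
Qed.

(** Take u(x) = 1 ⊗ x into S ⊗_R S with S acting on the left factor: then u(s) = s u(1) reads 1 ⊗ s
    = s ⊗ 1. Serves both ρ and η. *)
Lemma linear_tens_symmetric :
  (forall (N : gmod S) (u : gres h (greg S) -> gres h N),
     is_ghom u -> forall s : S, u s = s *: (u (1 : S) : N)) ->
  tens_symmetric.
Proof.
move=> lin s; pose N := gext h (gres h (greg S)).
pose u (x : gres h (greg S)) : gres h N := tens ((1 : S) : hS) (x : hS).
suff hu : is_ghom u.
  have := lin N u hu s; rewrite /u [RHS]gext_scaleE mulr1 => e.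
  exact: esym e.
(* Tensoring with 1 preserves degrees, since 1 has degree 0. *)
apply: (@is_ghom_shift _ _ _ _ 0); apply: hom_shiftP => [r x y|a x hx].
  rewrite /u tensDr -tensZ; congr (_ + _).
  exact/esym/gext_scaleE.
apply: (@tensor_homog_tens _ _ (gres h (greg S)) (gres h (greg S))) => //.
exact: gring_deg1.
Qed.

(** By surjectivity of ρ, every [u] has the form t ↦ t y, whence y = u(1). *)
Lemma rho_tens_symmetric :
  (forall N : gmod S, gmod_iso (rho_hom h N)) -> tens_symmetric.
Proof.
move=> iso; apply: linear_tens_symmetric => N u hu s.
have [f' _ f'K] := iso N.
have e t : u t = (t : S) *: f' (ghom_of hu).
  by rewrite -(rho_homE h) f'K.
by rewrite !e scale1r.
Qed.

(** By surjectivity of η, every [u] underlies an S-linear map on S, which is determined by its value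
    at 1. *)
Lemma eta_tens_symmetric :
  (forall N : gmod S, gmod_iso (eta_hom h (greg S) N)) -> tens_symmetric.
Proof.
move=> iso; apply: linear_tens_symmetric => N u hu s.
have [f' _ f'K] := iso N.
have e t : u t = ghom_fun (f' (ghom_of hu)) t by rewrite -(eta_homE h) f'K.
rewrite !e; exact: (linear_greg (is_ghom_linear (is_ghomP (f' (ghom_of hu))))).
Qed.

End TensSymmetric.

Theorem mainTheorem1 (G : zmodType) (R S : gring G) (h : gring_hom R S) :
  [<-> gring_epi h;
       gmod_iso (sigma_hom h (greg S));
       forall N : gmod S, gmod_iso (sigma_hom h N);
       forall N : gmod S, gmod_iso (rho_hom h N);
       forall M N : gmod S, gmod_iso (gamma_hom h M N);
       forall M N : gmod S, gmod_iso (eta_hom h M N);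
       forall N : gmod S, gmod_iso (eta_hom h (greg S) N)].
Proof.
(* The implications are proved in a cycle; all but the sixth, a specialization to M = S, pass
   through [tens_symmetric]. *)
tfae.
- by move=> /epi_tens_symmetric; apply: tens_symmetric_sigma.
- move=> /gmod_iso_inj/sigma_tens_symmetric sym N; exact: tens_symmetric_sigma.
- move=> /(_ (greg S))/gmod_iso_inj/sigma_tens_symmetric sym N.
  exact: tens_symmetric_rho.
- move=> /rho_tens_symmetric sym M N; exact: tens_symmetric_gamma.
- move=> /(_ (greg S) (greg S))/gmod_iso_inj/gamma_tens_symmetric sym M N.
  exact: tens_symmetric_eta.
- by move=> iso N; apply: iso.
- by move=> /eta_tens_symmetric; apply: tens_symmetric_epi.
Qed.
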